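(* Let $d$ and $i$ be positive integers with $1\le i<d$, and let $H(d,i)$ be the configuration in the hypercube $Q_d$ given by $$H(d,i)=\Big\{(v_1,v_2,\ldots,v_d)\in\{0,1\}^d : \sum_{j=1}^{i}v_j \text{ is even}\Big\}.$$ Then the $d$-cube density of $H(d,i)$ is $$\lambda(H(d,i),d)=\binom{d}{i}\frac{i^i (d-i)^{d-i}}{d^d}.$$
   Context: The $n$-cube $Q_n$ is the graph with vertex set $V_n=\{0,1\}^n$, two vertices being adjacent iff they differ in exactly one coordinate. A configuration in $Q_n$ is a subset of $V_n$. For configurations $H,K$ in $Q_d$, $K$ is an exact copy of $H$ if some graph automorphism of $Q_d$ maps $H$ onto $K$. For $1\le d\le n$, a sub-$d$-cube $R$ of $Q_n$ is obtained by letting $d$ coordinates vary and fixing the other $n-d$ coordinates; there are $\binom{n}{d}2^{n-d}$ of them, and each is identified with $Q_d$ through its $d$ varying coordinates, so it makes sense to ask whether $S\cap R$ is an exact copy of $H$. For a configuration $H$ in $Q_d$ and $S\subseteq V_n$, let $g(H,d,n,S)$ be the number of sub-$d$-cubes $R$ of $Q_n$ such that $S\cap R$ is an exact copy of $H$, divided by $\binom{n}{d}2^{n-d}$. Let $\lambda(H,d,n)=\max_{S\subseteq V_n} g(H,d,n,S)$. This is nonincreasing in $n$, and the $d$-cube density of $H$ is $\lambda(H,d)=\lim_{n\to\infty}\lambda(H,d,n)$. *)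

(* Defs.v *)
From HB Require Import structures.
From mathcomp Require Import all_boot all_order all_algebra all_fingroup.
From mathcomp Require Import all_classical all_reals all_analysis.
Set Implicit Arguments.
Unset Strict Implicit.
Unset Printing Implicit Defensive.
Import Order.TTheory GRing.Theory Num.Theory.
Import numFieldNormedType.Exports.
Local Open Scope ring_scope.

Definition cube (n : nat) : finType := n.-tuple bool.

Definition cube_adj (n : nat) (u v : cube n) : bool :=
  #|[set j : 'I_n | tnth u j != tnth v j]| == 1%N.

Definition cube_aut (n : nat) (f : {perm (cube n)}) : bool :=
  [forall u, forall v, cube_adj (f u) (f v) == cube_adj u v].

Definition exact_copy (d : nat) (H K : {set cube d}) : bool :=
  [exists f : {perm (cube d)}, cube_aut f && (f @: H == K)].

(* A subcube of Q_n is encoded by the word [w] of length n with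
   [w j = Some b] when coordinate j is fixed to b and [w j = None] when
   coordinate j varies; distinct words give distinct vertex sets. *)
Definition varying (n : nat) (w : {ffun 'I_n -> option bool}) : {set 'I_n} :=
  [set j | w j == None].

Definition subcubes (d n : nat) : {set {ffun 'I_n -> option bool}} :=
  [set w | #|varying w| == d].

(* The identification of Q_d with a sub-d-cube: the k-th coordinate of [x] is
   placed in the k-th varying coordinate, in increasing order.  When
   #|varying w| = d, the index below is always < d, so the default value of
   [nth] is never used. *)
Definition subcube_vertex (d n : nat) (w : {ffun 'I_n -> option bool})
    (x : cube d) : cube n :=
  [tuple if w j is Some b then b else nth false x (index j (enum (varying w)))
   | j < n].

Definition subcube_trace (d n : nat) (S : {set cube n})
    (w : {ffun 'I_n -> option bool}) : {set cube d} :=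
  [set x | subcube_vertex w x \in S].

Definition copy_fraction (R : realType) (d n : nat) (H : {set cube d})
    (S : {set cube n}) : R :=
  #|[set w in subcubes d n | exact_copy H (subcube_trace d S w)]|%:R
  / ('C(n, d) * 2 ^ (n - d))%N%:R.

(* All values are nonnegative, so the neutral element 0 does not affect the
   maximum.  For n < d there is no sub-d-cube and the value is 0. *)
Definition max_copy_fraction (R : realType) (d : nat) (H : {set cube d})
    (n : nat) : R :=
  \big[Num.max/0]_(S : {set cube n}) copy_fraction R H S.

Definition cube_density (R : realType) (d : nat) (H : {set cube d}) : R :=
  limn (max_copy_fraction R H).

Definition even_prefix_config (d i : nat) : {set cube d} :=
  [set v | ~~ odd (\sum_(j < d | (j < i)%N) (tnth v j : bool))%N].

(* Main.v *)
Require Import Defs.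
From mathcomp Require Import all_boot all_order all_algebra all_fingroup.
From mathcomp Require Import all_classical all_reals all_analysis.
From mathcomp Require Import zify ring.
Import Order.TTheory GRing.Theory Num.Theory.
Import numFieldNormedType.Exports.
Local Open Scope ring_scope.

(** The idea is to count pairs (sub-d-cube, vertex of it) from the side of the
    vertex.  Call a coordinate j sensitive at a vertex v of Q_n when flipping
    v_j changes membership in S.  In the configuration H(d,i) every vertex of
    Q_d has exactly i sensitive coordinates, namely the first i ones, and the
    number of sensitive coordinates is an invariant of exact copies because it
    counts neighbours of different status.  So if a sub-d-cube R through v
    carries a copy of H(d,i), its d directions comprise exactly i coordinates
    sensitive at v for S.  When v has a sensitive coordinates, at most
    C(a,i) C(n-a,d-i) direction sets are possible.  A sub-d-cube is determined
    by one of its vertices together with its direction set, and it has 2^d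
    vertices; summing over the 2^n vertices v bounds the fraction of copies by
    the maximum over a of C(a,i) C(n-a,d-i) / C(n,d) ([card_copies_le],
    [copy_fraction_le]).

    The bound is attained.  Take S to be the set of vertices of Q_n whose first
    a coordinates have even sum.  All vertices then have the same a sensitive
    coordinates, and conversely every sub-d-cube with exactly i directions
    among them carries a copy of H(d,i), up to a flip when the fixed
    coordinates contribute an odd sum ([card_copies_even_prefix]).

    It remains to compute the limit of the maximum of
    C(a,i) C(n-a,d-i) / C(n,d), which behaves like C(d,i) x^i (1-x)^(d-i) with
    x = a/n.  The weighted inequality between arithmetic and geometric means
    gives the upper bound i^i (d-i)^(d-i) / d^d for x^i (1-x)^(d-i)
    ([draw_fraction_le]), the choice a = floor (i n / d) shows that it is
    asymptotically sharp ([draw_fraction_ge]), and both errors are polynomial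
    expressions in 1/n, so that the limit follows by squeezing
    ([cvg_max_copy_fraction]). *)

Set Implicit Arguments.
Unset Strict Implicit.
Unset Printing Implicit Defensive.

(** * Sensitive coordinates *)

Definition flip (n : nat) (v : cube n) (k : 'I_n) : cube n :=
  [tuple tnth v j (+) (j == k) | j < n].

Lemma tnth_flip (n : nat) (v : cube n) (k j : 'I_n) :
  tnth (flip v k) j = tnth v j (+) (j == k).
Proof. by rewrite tnth_mktuple. Qed.

Lemma flip_inj (n : nat) (v : cube n) : injective (flip v).
Proof.
move=> k l /(congr1 (fun u => tnth u k)); rewrite !tnth_flip eqxx => /addbI.
by move/esym/eqP.
Qed.

Lemma flipK (n : nat) (k : 'I_n) : involutive (fun v : cube n => flip v k).
Proof. by move=> v; apply: eq_from_tnth => j; rewrite !tnth_flip addbK. Qed.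

Lemma cube_adjE (n : nat) (u v : cube n) :
  cube_adj u v = (v \in [set flip u k | k : 'I_n]).
Proof.
apply/cards1P/imsetP => [[k def_k]|[k _ ->]]; exists k => //.
  apply: eq_from_tnth => j; rewrite tnth_flip.
  have /setP/(_ j) := def_k; rewrite !inE => <-.
  by case: (tnth u j); case: (tnth v j).
by apply/setP=> j; rewrite !inE tnth_flip; case: (tnth u j); case: (j == k).
Qed.

(** The coordinates at which the indicator function of [S] is sensitive at [v],
    in the sense of Boolean function complexity. *)
Definition sensitive (n : nat) (S : {set cube n}) (v : cube n) : {set 'I_n} :=
  [set j | (v \in S) != (flip v j \in S)].

(** The right-hand side mentions only adjacency and membership, so it is
    visibly invariant under cube automorphisms, unlike [sensitive] itself. *)
Lemma card_sensitive (n : nat) (S : {set cube n}) (v : cube n) :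
  #|sensitive S v| =
  #|[set u | cube_adj v u && ((v \in S) != (u \in S))]|.
Proof.
rewrite -(card_imset _ (@flip_inj n v)); apply: eq_card => u.
rewrite inE cube_adjE; apply/imsetP/andP => [[k]|[/imsetP[k _ ->] ne]].
  by rewrite inE => ne ->; split=> //; apply: imset_f.
by exists k; rewrite ?inE.
Qed.

(** A configuration whose sensitivity is constant passes this constant on to
    all its exact copies; this is the only property of copies that the upper
    bound uses. *)
Lemma card_sensitive_copy (d i : nat) (H K : {set cube d}) :
    exact_copy H K -> (forall y, #|sensitive H y| = i) ->
  forall x, #|sensitive K x| = i.
Proof.
case/existsP=> f /andP[/forallP aut_f /eqP <-] degH x.
have memf y : (f y \in f @: H) = (y \in H) by rewrite mem_imset //; apply: perm_inj.
rewrite -(degH ((f^-1)%g x)) !card_sensitive.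
rewrite -[RHS](card_imset _ (@perm_inj _ f)).
apply: eq_card => u; rewrite -[in RHS](permKV f u) (mem_imset _ _ (@perm_inj _ f)) !inE.
have /forallP/(_ ((f^-1)%g u))/eqP := aut_f ((f^-1)%g x).
by rewrite -!memf !permKV => <-.
Qed.

(** * Parity configurations *)

Lemma odd_sum_bool (I : finType) (P : pred I) (F : I -> bool) :
  odd (\sum_(j | P j) F j) = \big[addb/false]_(j | P j) F j.
Proof. by rewrite (big_morph odd oddD (erefl _)); apply: eq_bigr => j _; case: F. Qed.

Lemma in_even_prefix (n a : nat) (v : cube n) :
  (v \in even_prefix_config n a) =
  ~~ \big[addb/false]_(j < n | (j < a)%N) tnth v j.
Proof. by rewrite inE odd_sum_bool. Qed.

Lemma even_prefix_flip (n a : nat) (v : cube n) (k : 'I_n) :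
  (flip v k \in even_prefix_config n a) =
  (v \in even_prefix_config n a) (+) (k < a)%N.
Proof.
rewrite !in_even_prefix (eq_bigr _ (fun j _ => tnth_flip v k j)) big_split /=.
rewrite -addNb; congr (_ (+) _); case: ltnP => [lt_ka|le_ak].
  by rewrite (bigD1 k) //= eqxx big1 // => j /andP[_ /negbTE].
rewrite big1 // => j lt_ja; apply: contraTF lt_ja => /eqP ->.
by rewrite -leqNgt.
Qed.

Definition prefix_coords (n a : nat) : {set 'I_n} := [set j : 'I_n | (j < a)%N].

Lemma sensitive_even_prefix (n a : nat) (v : cube n) :
  sensitive (even_prefix_config n a) v = prefix_coords n a.
Proof.
apply/setP=> j; have -> : (j \in sensitive (even_prefix_config n a) v) =
  ((v \in even_prefix_config n a) != (flip v j \in even_prefix_config n a)).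
  by rewrite [LHS]finset.inE.
rewrite even_prefix_flip [RHS]finset.inE.
by case: (v \in even_prefix_config n a); case: (j < a)%N.
Qed.

Lemma card_ord_prefix (n a : nat) :
  (a <= n)%N -> #|prefix_coords n a| = a.
Proof.
move=> le_an; rewrite -[RHS]card_ord.
have widen_inj : injective (widen_ord le_an).
  by move=> k l /(congr1 val) /= /val_inj.
rewrite -(card_imset _ widen_inj); apply: eq_card => j; rewrite inE.
apply/idP/imsetP => [lt_ja|[k _ ->]] //=.
by exists (Ordinal lt_ja) => //; apply: val_inj.
Qed.

Lemma flip_aut (n : nat) (k : 'I_n) : cube_aut (perm (inv_inj (@flipK n k))).
Proof.
apply/forallP=> u; apply/forallP=> v; rewrite !permE /cube_adj.
apply/eqP; congr (_ == 1)%N; apply: eq_card => j.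
by rewrite !inE !tnth_flip (inj_eq (can_inj (addbK _))).
Qed.

Lemma id_aut (n : nat) : cube_aut (1%g : {perm cube n}).
Proof. by apply/forallP=> u; apply/forallP=> v; rewrite !perm1. Qed.

(** The odd version of H(d,i) is also a copy of it: as i > 0, flipping the first
    coordinate exchanges the two parities. *)
Lemma exact_copy_parity (d i : nat) (c : bool) (K : {set cube d}) :
    (0 < i <= d)%N ->
    (forall x, (x \in K) = (x \in even_prefix_config d i) (+) c) ->
  exact_copy (even_prefix_config d i) K.
Proof.
case: d K => [|d] K /andP[i0 le_id]; first by case: i i0 le_id.
move=> defK; apply/existsP; case: c defK => defK; last first.
  exists 1%g; rewrite id_aut; apply/eqP/setP=> x.
  by rewrite defK addbF -{1}[x](perm1) mem_imset //; apply: perm_inj.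
exists (perm (inv_inj (@flipK _ ord0))); rewrite flip_aut.
apply/eqP/setP=> x; rewrite -{1}[x](flipK ord0).
rewrite -(permE (inv_inj (flipK ord0))) mem_imset; last exact: perm_inj.
by rewrite defK even_prefix_flip i0.
Qed.

(** * Sub-cubes and their directions *)

Lemma tnth_subcube_fixed (n d : nat) (w : {ffun 'I_n -> option bool})
    (x : cube d) (j : 'I_n) :
  j \notin varying w -> Some (tnth (subcube_vertex w x) j) = w j.
Proof. by rewrite inE tnth_mktuple; case: (w j). Qed.

Lemma tnth_subcube_varying (n : nat) (w : {ffun 'I_n -> option bool})
    (x : cube #|varying w|) (k : 'I_#|varying w|) :
  tnth (subcube_vertex w x) (enum_val k) = tnth x k.
Proof.
rewrite tnth_mktuple; have := enum_valP k; rewrite inE => /eqP ->.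
by rewrite /enum_val index_uniq ?enum_uniq -?cardE // (tnth_nth false).
Qed.

Lemma subcube_vertex_flip (n : nat) (w : {ffun 'I_n -> option bool})
    (x : cube #|varying w|) (k : 'I_#|varying w|) :
  subcube_vertex w (flip x k) = flip (subcube_vertex w x) (enum_val k).
Proof.
apply: eq_from_tnth => j; rewrite tnth_flip.
have [Vj|V'j] := boolP (j \in varying w).
  rewrite -(enum_rankK_in Vj Vj) !tnth_subcube_varying tnth_flip.
  by rewrite (inj_eq enum_val_inj).
have [def_j|_] := eqVneq j (enum_val k); first by rewrite def_j enum_valP in V'j.
have := tnth_subcube_fixed x V'j.
by rewrite -(tnth_subcube_fixed (flip x k) V'j) addbF => -[].
Qed.

(** Moving along a direction of the sub-cube is flipping the corresponding
    coordinate of Q_n, so sensitivity inside the sub-cube is sensitivity in Q_n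
    restricted to the directions. *)
Lemma card_sensitive_subcube (n d : nat) (S : {set cube n})
    (w : {ffun 'I_n -> option bool}) (x : cube d) :
    #|varying w| = d ->
  #|varying w :&: sensitive S (subcube_vertex w x)| =
  #|sensitive (subcube_trace d S w) x|.
Proof.
move=> def_d; subst d; rewrite -(card_imset _ (@enum_val_inj _ (varying w))).
apply: eq_card => j; apply/setIP/imsetP => [[Vj]|[k]].
  rewrite -(enum_rankK_in Vj Vj); set k := enum_rank_in Vj j => Sj.
  by exists k => //; rewrite !inE in Sj *; rewrite subcube_vertex_flip.
move=> Sk ->; split; first exact: enum_valP.
by move: Sk; rewrite !inE subcube_vertex_flip.
Qed.

Lemma enum_val_ltn (n : nat) (A : {set 'I_n}) (k l : 'I_#|A|) :
  (k < l)%N -> (enum_val k < enum_val l)%N.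
Proof.
have srt : sorted ltn [seq val j | j <- enum A].
  rewrite /enum_mem -enumT sorted_map.
  apply: sorted_filter => [x y z|]; first exact: ltn_trans.
  by rewrite -sorted_map val_enum_ord iota_ltn_sorted.
move=> lt_kl; have def_val (m : 'I_#|A|) :
    val (enum_val m) = nth 0%N [seq val j | j <- enum A] m.
  by rewrite (nth_map (enum_default m)) -?cardE.
rewrite !def_val; apply: (sorted_ltn_nth ltn_trans) => //;
by rewrite inE size_map -cardE.
Qed.

(** Because directions are listed in increasing order, those below [a] come
    first: being downward closed of size [i], they are the directions numbered
    less than [i]. *)
Lemma enum_val_prefix (n a i : nat) (V : {set 'I_n}) (k : 'I_#|V|) :
    #|V :&: prefix_coords n a| = i ->
  (enum_val k < a)%N = (k < i)%N.
Proof.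
set B := [set k : 'I_#|V| | (enum_val k < a)%N] => cardVa.
have cardB : #|B| = i.
  rewrite -cardVa -(card_imset _ (@enum_val_inj _ V)); apply: eq_card => j.
  apply/imsetP/setIP => [[l]|[Vj]]; rewrite !inE.
    by move=> ltl ->; split=> //; apply: enum_valP.
  by exists (enum_rank_in Vj j); rewrite ?inE enum_rankK_in.
have le_iV : (i <= #|V|)%N by rewrite -cardB -[leqRHS]card_ord max_card.
suff sB : B \subset [set l : 'I_#|V| | (l < i)%N].
  have /setP/(_ k) : B = [set l : 'I_#|V| | (l < i)%N].
    by apply/eqP; rewrite eqEcard sB card_ord_prefix // cardB leqnn.
  by rewrite !inE.
apply/fintype.subsetP=> l; rewrite !inE => lta.
rewrite -cardB -(card_ord_prefix (ltn_ord l)); apply: subset_leq_card.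
apply/fintype.subsetP=> m; rewrite !inE ltnS leq_eqVlt => /orP[/eqP/val_inj -> //|].
by move/enum_val_ltn => ltm; apply: ltn_trans ltm lta.
Qed.

(** The parity of the first [a] coordinates splits into the contribution [c] of
    the fixed ones, a constant on the sub-cube, and that of the varying ones,
    which are the first [i] coordinates of Q_d. *)
Lemma exact_copy_even_prefix (n d a i : nat) (w : {ffun 'I_n -> option bool}) :
    (0 < i <= d)%N -> #|varying w| = d ->
    #|varying w :&: prefix_coords n a| = i ->
  exact_copy (even_prefix_config d i)
             (subcube_trace d (even_prefix_config n a) w).
Proof.
move=> hi def_d; subst d => cardi.
pose c := \big[addb/false]_(j < n | (j < a)%N && (j \notin varying w))
             odflt false (w j).
apply: (@exact_copy_parity _ _ c) => // x.
have -> : (x \in subcube_trace #|varying w| (even_prefix_config n a) w) =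
          (subcube_vertex w x \in even_prefix_config n a) by rewrite [LHS]finset.inE.
rewrite !in_even_prefix addNb; congr (~~ _).
rewrite (bigID (mem (varying w))) /=; congr (_ (+) _).
  rewrite (eq_bigl (fun j => (j \in varying w) && (j < a)%N)); last first.
    by move=> j; rewrite andbC.
  rewrite big_enum_val_cond /=; apply: eq_big => [k|k _].
    exact: enum_val_prefix.
  exact: tnth_subcube_varying.
by apply: eq_bigr => j /andP[_ V'j]; rewrite -(tnth_subcube_fixed x V'j).
Qed.

(** * Double counting *)

Definition subcube_through (n : nat) (v : cube n) (V : {set 'I_n}) :
    {ffun 'I_n -> option bool} :=
  [ffun j => if j \in V then None else Some (tnth v j)].

(** The coordinates of [v] inside the sub-cube through [v] with directions [V].
    Indices are natural numbers so that default values exist for every [n];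
    they are not reached when [V] has [d] elements. *)
Definition subcube_coord (n d : nat) (v : cube n) (V : {set 'I_n}) : cube d :=
  [tuple nth false v (nth 0%N [seq val j | j <- enum V] k) | k < d].

Lemma varying_through (n : nat) (v : cube n) (V : {set 'I_n}) :
  varying (subcube_through v V) = V.
Proof. by apply/setP=> j; rewrite inE ffunE; case: ifP. Qed.

Lemma tnth_subcube_coord (n : nat) (v : cube n) (V : {set 'I_n}) (k : 'I_#|V|) :
  tnth (subcube_coord #|V| v V) k = tnth v (enum_val k).
Proof.
rewrite tnth_mktuple (nth_map (enum_default k)) -?cardE //.
by rewrite (tnth_nth false).
Qed.

(** A sub-d-cube with a marked vertex is the same as a vertex of Q_n with a set
    of [d] directions. *)
Lemma subcube_double_count (n d : nat) (F : cube n -> {set 'I_n} -> nat) :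
  (\sum_(w in subcubes d n) \sum_(x : cube d) F (subcube_vertex w x) (varying w)
   = \sum_(v : cube n) \sum_(V : {set 'I_n} | #|V| == d) F v V)%N.
Proof.
rewrite !pair_big /=.
rewrite (reindex_onto (fun p => (subcube_through p.1 p.2, subcube_coord d p.1 p.2))
  (fun q => (subcube_vertex q.1 q.2, varying q.1))) /=; last first.
  case=> w x; rewrite inE andbT => /eqP /= def_d; subst d; congr (_, _).
    apply/ffunP=> j; rewrite ffunE; case: ifPn => [|V'j].
      by rewrite inE => /eqP.
    by rewrite tnth_subcube_fixed.
  by apply: eq_from_tnth => k; rewrite tnth_subcube_coord tnth_subcube_varying.
have thruK (v : cube n) (V : {set 'I_n}) : #|V| = d ->
    subcube_vertex (subcube_through v V) (subcube_coord d v V) = v.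
  move=> def_d; subst d; apply: eq_from_tnth => j.
  have [Vj|V'j] := boolP (j \in V); last first.
    by apply: Some_inj; rewrite tnth_subcube_fixed ?varying_through // ffunE (negbTE V'j).
  rewrite tnth_mktuple ffunE Vj varying_through.
  rewrite -[j in RHS](enum_rankK_in Vj Vj) -tnth_subcube_coord (tnth_nth false).
  congr (nth _ _ _); rewrite -{1}(enum_rankK_in Vj Vj) /enum_val.
  by rewrite index_uniq ?enum_uniq -?cardE.
apply: eq_big => [[v V]|[v V]] /=; rewrite !inE varying_through andbT.
  by case: eqP => //= def_d; rewrite thruK ?eqxx.
by case/andP=> /eqP def_d _; rewrite thruK.
Qed.

(** A set is determined by its traces on [A] and on the complement of [A], which
    can be chosen independently. *)
Lemma card_draws_split (T : finType) (A : {set T}) (i e : nat) :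
  #|[set V : {set T} | (#|V :&: A| == i) && (#|V :\: A| == e)]| =
  ('C(#|A|, i) * 'C(#|~: A|, e))%N.
Proof.
rewrite -!cards_draws -cardsX.
have split_inj : injective (fun V : {set T} => (V :&: A, V :\: A)).
  by move=> V W [eqI eqD]; rewrite -(finset.setID V A) eqI eqD finset.setID.
rewrite -(card_imset _ split_inj); apply: eq_card => -[B C].
apply/imsetP/setXP => [[V]|[]]; rewrite !inE.
  by case/andP=> cI cD [-> ->]; rewrite subsetIr subsetDr.
move=> /andP[sBA cB] /andP[sCA cC].
have defB : (B :|: C) :&: A = B.
  rewrite finset.setIUl (finset.setIidPl sBA); apply/finset.setUidPl.
  apply/fintype.subsetP=> x.
  by rewrite inE => /andP[/(fintype.subsetP sCA)]; rewrite inE => /negbTE ->.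
have defC : (B :|: C) :\: A = C.
  rewrite finset.setDUl; have := sBA; rewrite -finset.setD_eq0 => /eqP ->.
  by rewrite finset.set0U; apply/finset.setDidPl; rewrite finset.disjoints_subset.
by exists (B :|: C); rewrite ?inE ?defB ?defC ?cB.
Qed.

Lemma card_draws_meet (n d i : nat) (A : {set 'I_n}) : (i <= d)%N ->
  (\sum_(V : {set 'I_n} | #|V| == d) (#|V :&: A| == i)
   = 'C(#|A|, i) * 'C(n - #|A|, d - i))%N.
Proof.
move=> le_id; have -> : (n - #|A|)%N = #|~: A| by rewrite [RHS]cardsCs finset.setCK card_ord.
rewrite -card_draws_split.
rewrite -sum1dep_card big_mkcond [RHS]big_mkcond; apply: eq_bigr => V _.
rewrite -(cardsID A V); have [->|_] := eqVneq #|V :&: A| i; last by case: ifP.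
by rewrite -{1}(subnKC le_id) eqn_add2l; case: eqP.
Qed.

(** At each vertex of a copy, exactly [i] of the [d] directions are sensitive;
    the right-hand side counts all pairs (vertex, direction set) with this
    property. *)
Lemma card_copies_le (n d i : nat) (S : {set cube n}) : (i <= d)%N ->
  (#|[set w in subcubes d n | exact_copy (even_prefix_config d i)
                                          (subcube_trace d S w)]| * 2 ^ d
   <= \sum_(v : cube n) 'C(#|sensitive S v|, i) *
                        'C(n - #|sensitive S v|, d - i))%N.
Proof.
move=> le_id; under eq_bigr do rewrite -card_draws_meet //.
rewrite -(subcube_double_count d (fun v V => (#|V :&: sensitive S v| == i) : nat)).
rewrite -sum1dep_card big_distrl /= big_mkcondr; apply: leq_sum => w.
rewrite inE => /eqP def_d; case: ifP => // copy_w.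
rewrite mul1n -[2%N]card_bool -card_tuple -sum1_card; apply: leq_sum => x _.
rewrite card_sensitive_subcube // (card_sensitive_copy (i := i) copy_w) ?eqxx // => y.
by rewrite sensitive_even_prefix card_ord_prefix.
Qed.

(** For the parity of the first [a] coordinates the condition on the directions
    is also sufficient, and the sensitive set is the same at all [2 ^ n]
    vertices. *)
Lemma card_copies_even_prefix (n d i a : nat) : (0 < i <= d)%N -> (a <= n)%N ->
  (2 ^ n * ('C(a, i) * 'C(n - a, d - i)) <=
   #|[set w in subcubes d n | exact_copy (even_prefix_config d i)
           (subcube_trace d (even_prefix_config n a) w)]| * 2 ^ d)%N.
Proof.
move=> hi le_an; have [i0 le_id] := andP hi.
pose A := prefix_coords n a.
have cardA : #|A| = a by apply: card_ord_prefix.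
rewrite -{1 2}cardA -card_draws_meet // -{1}[2%N]card_bool -card_tuple.
have := subcube_double_count d
  (fun (_ : cube n) V => (#|V :&: A| == i) : nat); rewrite sum_nat_const => <-.
rewrite -sum1dep_card big_distrl /= [leqRHS]big_mkcondr; apply: leq_sum => w.
rewrite inE => /eqP def_d; rewrite sum_nat_const card_tuple card_bool.
case: eqP => [cardi|_]; last by rewrite muln0.
by rewrite exact_copy_even_prefix // muln1 mul1n.
Qed.

(** * From counts to fractions *)

Lemma ffact_leX (n m : nat) : (n ^_ m <= n ^ m)%N.
Proof.
rewrite ffact_prod -[m in (_ ^ m)%N]card_ord -prod_nat_const.
by apply: leq_prod => j _; apply: leq_subr.
Qed.

Lemma ffact_geX (n m : nat) : ((n - m) ^ m <= n ^_ m)%N.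
Proof.
rewrite ffact_prod -[m in (_ ^ m)%N]card_ord -prod_nat_const.
by apply: leq_prod => j _; apply: leq_sub2l; apply: ltnW.
Qed.

(** The hypergeometric probability that a uniformly random [d]-subset of an
    [n]-set meets a given [a]-subset in [i] elements. *)
Definition draw_fraction (R : realFieldType) (d i n a : nat) : R :=
  ('C(a, i) * 'C(n - a, d - i))%:R / 'C(n, d)%:R.

(** Falling factorials are easier than binomials to compare with powers. *)
Lemma draw_fractionE (R : realFieldType) (d i n a : nat) : (i <= d <= n)%N ->
  draw_fraction R d i n a =
  'C(d, i)%:R * ((a ^_ i)%:R * ((n - a) ^_ (d - i))%:R) / (n ^_ d)%:R.
Proof.
move=> /andP[le_id le_dn]; rewrite /draw_fraction -!bin_ffact.
rewrite -(bin_fact le_id) !natrM.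
have := fact_gt0 i; have := fact_gt0 (d - i); have := le_dn.
rewrite -bin_gt0; have := le_id; rewrite -bin_gt0.
rewrite -4!(ltr0n R) => /lt0r_neq0 n1 /lt0r_neq0 n2 /lt0r_neq0 n3 /lt0r_neq0 n4.
by field; rewrite n1 n2 n3 n4.
Qed.

Lemma copy_fraction_le (R : realType) (d i n : nat) (M : R) (S : {set cube n}) :
    (i <= d <= n)%N ->
    (forall a, (a <= n)%N -> draw_fraction R d i n a <= M) ->
  copy_fraction R (even_prefix_config d i) S <= M.
Proof.
move=> /andP[le_id le_dn] leM.
have Cgt0 : 0 < 'C(n, d)%:R :> R by rewrite ltr0n bin_gt0.
have Pgt0 m : 0 < (2 ^ m)%:R :> R by rewrite ltr0n expn_gt0.
rewrite /copy_fraction; set N := #|_|.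
have leN : N%:R * (2 ^ d)%:R <= \sum_(v : cube n)
    ('C(#|sensitive S v|, i) * 'C(n - #|sensitive S v|, d - i))%:R :> R.
  by rewrite -natrM -natr_sum ler_nat card_copies_le.
rewrite natrM ler_pdivrMr ?mulr_gt0 // -(ler_pM2r (Pgt0 d)).
apply: le_trans leN _; rewrite -!mulrA -natrM -expnD subnK //.
have -> : M * ('C(n, d)%:R * (2 ^ n)%:R) = \sum_(v : cube n) (M * 'C(n, d)%:R).
  by rewrite sumr_const card_tuple card_bool mulrA mulr_natr.
apply: ler_sum => v _; rewrite -ler_pdivrMr //; apply: leM.
by rewrite -[leqRHS]card_ord max_card.
Qed.

Lemma copy_fraction_even_prefix (R : realType) (d i n a : nat) :
    (0 < i <= d)%N -> (d <= n)%N -> (a <= n)%N ->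
  draw_fraction R d i n a <=
  copy_fraction R (even_prefix_config d i) (even_prefix_config n a).
Proof.
move=> hi le_dn le_an; rewrite /copy_fraction /draw_fraction.
have Cgt0 : 0 < 'C(n, d)%:R :> R by rewrite ltr0n bin_gt0.
have Pgt0 m : 0 < (2 ^ m)%:R :> R by rewrite ltr0n expn_gt0.
set N := #|_|; rewrite ler_pdivrMr // [('C(n, d) * _)%:R]natrM invfM.
rewrite [_^-1 / _]mulrC mulrA mulfVK ?gt_eqF //.
rewrite ler_pdivlMr // -natrM ler_nat -(@leq_pmul2r (2 ^ d)) ?expn_gt0 //.
apply: leq_trans (card_copies_even_prefix hi le_an).
by rewrite -mulnA -expnD subnK // mulnC.
Qed.

(** * Asymptotics *)

(** The maximum of x^i (1 - x)^e on [0, 1], attained at x = i / (i + e). *)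
Definition peak (R : realFieldType) (i e : nat) : R :=
  i%:R ^+ i * e%:R ^+ e / (i + e)%:R ^+ (i + e).

(** The inequality of arithmetic and geometric means for [i] copies of [x / i]
    and [e] copies of [y / e], whose sum is [x + y]. *)
Lemma weighted_AGM (R : realFieldType) (i e : nat) (x y : R) : (0 < i)%N -> (0 < e)%N ->
  0 <= x -> 0 <= y -> x ^+ i * y ^+ e <= peak R i e * (x + y) ^+ (i + e).
Proof.
move=> i0 e0 x0 y0; rewrite -(ltr0n R) in i0; rewrite -(ltr0n R) in e0.
pose E (t : 'I_i + 'I_e) : R := if t is inl _ then x / i%:R else y / e%:R.
have E0 : {in predT, forall t, 0 <= E t}.
  by case=> t _; rewrite divr_ge0 // ltW.
have := (leif_AGM E0).1; rewrite card_sum !card_ord.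
have -> : \sum_(t in predT) E t = x + y.
  transitivity (\sum_t E t); first exact: eq_bigl.
  rewrite big_sumType /= !sumr_const !card_ord.
  rewrite -[x / _ *+ i]mulr_natr -[y / _ *+ e]mulr_natr.
  by rewrite !divfK ?gt_eqF.
have -> : \prod_(t in predT) E t = (x / i%:R) ^+ i * (y / e%:R) ^+ e.
  transitivity (\prod_t E t); first exact: eq_bigl.
  by rewrite big_sumType /= !prodr_const !card_ord.
rewrite !expr_div_n => AGM.
rewrite /peak mulrAC -mulrA -ler_pdivrMl ?mulr_gt0 ?exprn_gt0 //.
by apply: le_trans AGM; rewrite invfM mulrACA [_ * x ^+ _]mulrC [_ * y ^+ _]mulrC.
Qed.

(** Each falling factorial in the numerator is at most a power, and the one in
    the denominator is at least [(n - d) ^ d]; the last factor is the price of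
    comparing the latter with [n ^ d]. *)
Lemma draw_fraction_le (R : realFieldType) (d i n a : nat) :
    (0 < i < d)%N -> (d < n)%N -> (a <= n)%N ->
  draw_fraction R d i n a <=
  'C(d, i)%:R * peak R i (d - i) / (1 - d%:R * n%:R^-1) ^+ d.
Proof.
move=> /andP[i0 lt_id] lt_dn le_an.
have n0 : 0 < n%:R :> R by rewrite ltr0n (leq_ltn_trans _ lt_dn).
have nd0 : 0 < (n - d)%:R :> R by rewrite ltr0n subn_gt0.
have f0 : 0 < (n ^_ d)%:R :> R by rewrite ltr0n ffact_gt0 ltnW.
rewrite draw_fractionE; last by rewrite (ltnW lt_id) (ltnW lt_dn).
have -> : 1 - d%:R * n%:R^-1 = (n - d)%:R / n%:R :> R.
  by rewrite natrB ?(ltnW lt_dn) // mulrBl divff ?gt_eqF.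
have := weighted_AGM i0 _ (ler0n R a) (ler0n R (n - a)).
move/(_ (d - i)%N); rewrite subn_gt0 lt_id -natrD !subnKC ?(ltnW lt_id) //.
move/(_ isT).
have : 0 <= peak R i (d - i) by rewrite divr_ge0 ?mulr_ge0 ?exprn_ge0.
move: (peak _ _ _) => P P0 AGM.
rewrite -!mulrA ler_wpM2l // [leLHS]mulrA ler_pdivrMr //.
rewrite expr_div_n invf_div -!mulrA.
apply: (@le_trans _ _ (P * n%:R ^+ d)); last first.
    rewrite ler_wpM2l // ler_peMr ?mulr_ge0 ?exprn_ge0 ?(ltW n0) //.
    rewrite ler_pdivlMl ?exprn_gt0 // mulr1.
    by rewrite -natrX ler_nat ffact_geX.
apply: le_trans AGM; rewrite -!natrX -!natrM ler_nat.
by apply: leq_mul; apply: ffact_leX.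
Qed.

(** Rounding [i n / d] down costs at most 1, and replacing a falling factorial
    of length at most [d] by a power costs at most [d]; relative to [n] both
    losses fit in [(d + 1) / n]. *)
Lemma draw_fraction_ge (R : realFieldType) (d i n : nat) :
    (0 < i < d)%N -> (0 < n)%N -> (d <= n)%N ->
    0 <= i%:R / d%:R - d.+1%:R * n%:R^-1 :> R ->
    0 <= (d - i)%:R / d%:R - d.+1%:R * n%:R^-1 :> R ->
  'C(d, i)%:R * ((i%:R / d%:R - d.+1%:R * n%:R^-1) ^+ i *
                 ((d - i)%:R / d%:R - d.+1%:R * n%:R^-1) ^+ (d - i))
  <= draw_fraction R d i n ((i * n) %/ d).
Proof.
move=> /andP[i0 lt_id] n0 le_dn pos_i pos_e.
set a := ((i * n) %/ d)%N; have le_id := ltnW lt_id.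
have d0 : (0 < d)%N by apply: leq_ltn_trans lt_id.
have le_an : (a <= n)%N.
  rewrite -(@leq_pmul2r d) //; apply: leq_trans (leq_divM _ _) _.
  by rewrite mulnC leq_mul2l le_id orbT.
have n0R : 0 < n%:R :> R by rewrite ltr0n.
have d0R : 0 < d%:R :> R by rewrite ltr0n.
have f0 : 0 < (n ^_ d)%:R :> R by rewrite ltr0n ffact_gt0.
rewrite draw_fractionE ?le_id // -mulrA ler_wpM2l // ler_pdivlMr //.
(* Applied to [c := i] and to [c := d - i], with [m] near [c n / d]. *)
have bound (c m p : nat) : (p <= d)%N -> (c * n <= m.+1 * d)%N ->
    0 <= c%:R / d%:R - d.+1%:R * n%:R^-1 :> R ->
  (c%:R / d%:R - d.+1%:R * n%:R^-1) ^+ p * n%:R ^+ p <= (m ^_ p)%:R :> R.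
  move=> le_pd le_cm pos; rewrite -exprMn.
  have le_sub : (c%:R / d%:R - d.+1%:R * n%:R^-1) * n%:R <= (m - p)%:R :> R.
    rewrite mulrBl divfK ?gt_eqF // mulrAC lerBlDr.
    rewrite ler_pdivrMr // -natrD -!natrM ler_nat; apply: leq_trans le_cm _.
    rewrite leq_mul2r; apply/orP; right; lia.
  apply: (@le_trans _ _ ((m - p)%:R ^+ p)).
    by apply: lerXn2r; rewrite // nnegrE ?ler0n // mulr_ge0.
  by rewrite -natrX ler_nat ffact_geX.
apply: (@le_trans _ _ (((i%:R / d%:R - d.+1%:R * n%:R^-1) ^+ i * n%:R ^+ i) *
  (((d - i)%:R / d%:R - d.+1%:R * n%:R^-1) ^+ (d - i) * n%:R ^+ (d - i)))).
  rewrite mulrACA -exprD subnKC // ler_wpM2l ?mulr_ge0 ?exprn_ge0 //.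
  by rewrite -natrX ler_nat ffact_leX.
have le_ia := ltn_ceil (i * n) d0; have ge_ia := leq_divM (i * n) d.
apply: ler_pM; rewrite ?mulr_ge0 ?exprn_ge0 ?(ltW n0R) //.
  by apply: bound => //; apply: ltnW.
apply: bound => //; first exact: leq_subr.
rewrite mulnBl mulSn mulnBl [(n * d)%N]mulnC.
rewrite -/a in ge_ia *; rewrite leq_subLR. nia.
Qed.

Lemma cvg_poly_inv (R : realType) (p : {poly R}) :
  ((fun n : nat => p.[n%:R^-1]) @ \oo --> p.[0])%classic.
Proof.
have inv0 : ((fun n : nat => n%:R^-1 : R) @ \oo --> (0 : R))%classic.
  by rewrite -cvg_shiftS; apply: cvg_harmonic.
by apply: (cvg_comp _ (horner p) inv0); apply: continuous_horner.
Qed.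

(** The lower and upper bounds on the maximum are rational in [1 / n], with a
    denominator equal to 1 at 0, and take the same value there. *)
Lemma cvg_max_copy_fraction (R : realType) (d i : nat) : (0 < i < d)%N ->
  (max_copy_fraction R (even_prefix_config d i) @ \oo
     --> 'C(d, i)%:R * peak R i (d - i))%classic.
Proof.
move=> hi; have /andP[i0 lt_id] := hi; have le_id := ltnW lt_id.
have d0 : (0 < d)%N by apply: leq_ltn_trans lt_id.
have d0R : 0 < d%:R :> R by rewrite ltr0n.
pose l (c : nat) : {poly R} := (c%:R / d%:R)%:P - d.+1%:R%:P * 'X.
have lE c x : (l c).[x] = c%:R / d%:R - d.+1%:R * x by rewrite !hornerE.
(* The lower bound compares powers of [l c], hence needs them nonnegative. *)
have near_pos c : (0 < c)%N -> \forall n \near \oo%classic, 0 <= (l c).[n%:R^-1].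
  move=> c0; apply: (@cvgr_ge _ _ _ _ _ (l c).[0]); first exact: cvg_poly_inv.
  by rewrite lE mulr0 subr0 divr_gt0 ?ltr0n.
pose lo : {poly R} := 'C(d, i)%:R%:P * (l i ^+ i * l (d - i)%N ^+ (d - i)).
pose up : {poly R} := (1 - d%:R%:P * 'X) ^+ d.
have lo0 : lo.[0] = 'C(d, i)%:R * peak R i (d - i).
  rewrite /lo !hornerM hornerC !horner_exp !lE !mulr0 !subr0 /peak subnKC //.
  by rewrite !expr_div_n mulf_div -exprD subnKC.
have up0 : up.[0] = 1 by rewrite /up !hornerE subr0 expr1n.
apply: (@squeeze_cvgr _ _ _ _ (fun n : nat => lo.[n%:R^-1])
          (fun n : nat => 'C(d, i)%:R * peak R i (d - i) / up.[n%:R^-1])).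
- near=> n.
  have lt_dn : (d < n)%N by near: n; apply: nbhs_infty_gt.
  have hdn : (i <= d <= n)%N by rewrite le_id ltnW.
  have n0 : (0 < n)%N by apply: leq_ltn_trans lt_dn.
  have -> : up.[n%:R^-1] = (1 - d%:R * n%:R^-1) ^+ d by rewrite /up !hornerE.
  have le_max S := le_bigmax 0 (@copy_fraction R d n (even_prefix_config d i)) S.
  apply/andP; split.
    apply: le_trans (le_max (even_prefix_config n ((i * n) %/ d))).
    have le_an : ((i * n) %/ d <= n)%N.
      rewrite -(@leq_pmul2r d) //; apply: leq_trans (leq_divM _ _) _.
      by rewrite mulnC leq_mul2l le_id orbT.
    have hi' : (0 < i <= d)%N by rewrite i0.
    apply: (@le_trans _ R (draw_fraction R d i n ((i * n) %/ d))); last first.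
      exact: (copy_fraction_even_prefix R hi' (ltnW lt_dn) le_an).
    rewrite /lo !hornerM hornerC !horner_exp !lE.
    apply: draw_fraction_ge => //; first exact: ltnW.
      by rewrite -lE; near: n; apply: near_pos.
    by rewrite -lE; near: n; apply: near_pos; rewrite subn_gt0.
  apply: bigmax_le => [|S _].
    by apply: le_trans (draw_fraction_le R hi lt_dn (leq0n n)); rewrite divr_ge0.
  by apply: copy_fraction_le => // a le_an; apply: (draw_fraction_le R hi).
- by rewrite -lo0; apply: cvg_poly_inv.
- rewrite -[X in (_ --> X)%classic]divr1; apply: cvgMl_tmp.
  apply: cvgV; first exact: oner_neq0.
  by have := @cvg_poly_inv R up; rewrite up0.
Unshelve. all: by end_near.
Qed.

Unset Implicit Arguments.

Theorem theorem6p1 (R : realType) (d i : nat) (hi : (1 <= i)%N)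
    (hid : (i < d)%N) :
  cvgn (max_copy_fraction R (even_prefix_config d i)) /\
  cube_density R (even_prefix_config d i) =
    'C(d, i)%:R * (i%:R ^+ i * (d - i)%N%:R ^+ (d - i)%N / d%:R ^+ d).
Proof.
have hid' : (0 < i < d)%N by rewrite hi.
have := @cvg_max_copy_fraction R d i hid'.
rewrite /peak subnKC ?(ltnW hid) // => cvg_max.
by split; [apply: cvgP cvg_max | apply: cvg_lim cvg_max].
Qed.
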